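(* Consider two rings in $\mathbb{R}^2$ with (inner, outer) radii $r_i,R_i$ and $r_j,R_j$ that intersect orthogonally. Then the two rings have the same area, i.e. $(R_i^2-r_i^2)\pi=(R_j^2-r_j^2)\pi$.
   Context: A ring is a pair of concentric circles in $\mathbb{R}^2$: an inner circle $c$ with signed radius $r\in\mathbb{R}$ (the sign encodes orientation) and an outer circle $C$ with radius $R>0$; its area is $(R^2-r^2)\pi$. Two rings $(c_i,C_i)$ and $(c_j,C_j)$ intersect orthogonally if the outer circle $C_i$ intersects the inner circle $c_j$ orthogonally and the outer circle $C_j$ intersects the inner circle $c_i$ orthogonally (if an inner circle has radius $0$, i.e. is a point, this means that the outer circle of the other ring passes through it). *)

(* Defs.v *)
From mathcomp Require Import all_boot all_order all_algebra.
From mathcomp Require Import all_classical all_reals all_analysis.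

Set Implicit Arguments.
Unset Strict Implicit.
Unset Printing Implicit Defensive.

Import Order.TTheory GRing.Theory Num.Theory.
Local Open Scope classical_set_scope.
Local Open Scope ring_scope.

Definition dot (R : realType) (u v : 'rV[R]_2) : R := \sum_i u 0 i * v 0 i.

(* The library norm [`|u|] on row vectors is the sup norm, not this one. *)
Definition enorm (R : realType) (u : 'rV[R]_2) : R := Num.sqrt (dot u u).

(* A signed radius and its opposite give the same point set: the sign of the
   radius only records an orientation. *)
Definition circle (R : realType) (c : 'rV[R]_2) (r : R) : set 'rV[R]_2 :=
  [set p | enorm (p - c) = `|r|].

(* Meaningful for [p] different from [c], where it is a line through 0. *)
Definition tangent_direction (R : realType) (c p : 'rV[R]_2) : set 'rV[R]_2 :=
  [set v | dot v (p - c) = 0].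

(* Orthogonal intersection of two circles of nonzero radius: they meet, and
   their tangent lines at every common point are perpendicular. *)
Definition orthogonal_circles (R : realType)
    (c1 : 'rV[R]_2) (r1 : R) (c2 : 'rV[R]_2) (r2 : R) : Prop :=
  circle c1 r1 `&` circle c2 r2 !=set0 /\
  forall p, (circle c1 r1 `&` circle c2 r2) p ->
    forall u v, tangent_direction c1 p u -> tangent_direction c2 p v ->
      dot u v = 0.

(* No order is imposed between [inner_radius] and [outer_radius]. *)
Record circle_ring (R : realType) := CircleRing {
  center : 'rV[R]_2;
  inner_radius : R;
  outer_radius : R;
  outer_radius_gt0 : 0 < outer_radius }.

Definition ring_area (R : realType) (A : circle_ring R) : R :=
  (outer_radius A ^+ 2 - inner_radius A ^+ 2) * pi.

Definition outer_inner_orthogonal (R : realType) (A B : circle_ring R) : Prop :=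
  if inner_radius B == 0 then circle (center A) (outer_radius A) (center B)
  else orthogonal_circles (center A) (outer_radius A)
                          (center B) (inner_radius B).

Definition orthogonal_rings (R : realType) (A B : circle_ring R) : Prop :=
  outer_inner_orthogonal A B /\ outer_inner_orthogonal B A.

(* Main.v *)
(** Two circles of radii [r] and [s] meeting orthogonally at [p] have radii
    vectors at [p] that are perpendicular, so by Pythagoras the squared distance
    of the centers is [r^2 + s^2]. Applied to the two pairs of circles of
    orthogonal rings this gives [R_i^2 + r_j^2 = R_j^2 + r_i^2]. *)
Require Import Defs.
From mathcomp Require Import all_boot all_order all_algebra.
From mathcomp Require Import all_classical all_reals all_analysis.
From mathcomp Require Import ring lra.

Import Order.TTheory GRing.Theory Num.Theory.
Local Open Scope ring_scope.

Lemma dotE (R : realType) (u v : 'rV[R]_2) :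
  dot u v = u 0 0 * v 0 0 + u 0 1 * v 0 1.
Proof.
rewrite /dot !big_ord_recl big_ord0 addr0.
by have -> : lift ord0 ord0 = 1 :> 'I_2 by apply: val_inj.
Qed.

Lemma dot_ge0 (R : realType) (u : 'rV[R]_2) : 0 <= dot u u.
Proof. by rewrite /dot sumr_ge0 // => i _; rewrite -expr2 sqr_ge0. Qed.

Lemma dotBB (R : realType) (u v : 'rV[R]_2) :
  dot (u - v) (u - v) = dot u u - dot u v *+ 2 + dot v v.
Proof. by rewrite !dotE !mxE; ring. Qed.

Lemma circle_dot (R : realType) (c : 'rV[R]_2) (r : R) (p : 'rV[R]_2) :
  circle c r p -> dot (p - c) (p - c) = r ^+ 2.
Proof.
rewrite /circle /enorm /= => e.
by rewrite -(sqr_sqrtr (dot_ge0 _ _)) e real_normK ?num_real.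
Qed.

(** The quarter turn makes a radius vector into an explicit tangent direction, at which the
    orthogonality hypothesis can be instantiated. *)
Definition rot90 (R : realType) (u : 'rV[R]_2) : 'rV[R]_2 :=
  \row_j (if j == 0 then - u 0 1 else u 0 0).

Lemma dot_rot90 (R : realType) (u : 'rV[R]_2) : dot (rot90 R u) u = 0.
Proof. by rewrite dotE !mxE /=; ring. Qed.

Lemma dot_rot90_rot90 (R : realType) (u v : 'rV[R]_2) :
  dot (rot90 R u) (rot90 R v) = dot u v.
Proof. by rewrite !dotE !mxE /=; ring. Qed.

Lemma orthogonal_circles_pythagoras (R : realType) (c1 c2 : 'rV[R]_2) (r1 r2 : R) :
  orthogonal_circles c1 r1 c2 r2 ->
  dot (c2 - c1) (c2 - c1) = r1 ^+ 2 + r2 ^+ 2.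
Proof.
move=> [[p [p1 p2]] orth].
(* The tangents tested are the two radius vectors turned by [rot90]; as a rotation preserves [dot],
   the radii themselves are perpendicular. *)
have perp : dot (p - c1) (p - c2) = 0.
  by rewrite -dot_rot90_rot90; apply: (orth p (conj p1 p2)); apply: dot_rot90.
have -> : c2 - c1 = (p - c1) - (p - c2) by rewrite opprB [RHS]addrC addrA subrK.
by rewrite dotBB perp (circle_dot _ _ _ _ p1) (circle_dot _ _ _ _ p2) mul0rn subr0.
Qed.

Lemma outer_inner_orthogonal_pythagoras (R : realType) (A B : circle_ring R) :
  outer_inner_orthogonal A B ->
  dot (Defs.center B - Defs.center A) (Defs.center B - Defs.center A)
  = outer_radius A ^+ 2 + inner_radius B ^+ 2.
Proof.
(* If the inner circle is a point, it lies on the outer circle of [A], and the Pythagorean formula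
   holds with a zero second term. *)
rewrite /outer_inner_orthogonal; case: eqP => [-> /circle_dot ->|_].
  by rewrite expr0n addr0.
exact: orthogonal_circles_pythagoras.
Qed.

Theorem lemma2p2 (R : realType) (A B : circle_ring R)
    (hAB : orthogonal_rings A B) :
  ring_area A = ring_area B.
Proof.
have [/outer_inner_orthogonal_pythagoras eAB
      /outer_inner_orthogonal_pythagoras eBA] := hAB.
(* [eAB] and [eBA] measure the same distance in opposite directions; equating them leaves an
   identity linear in the squared radii. *)
have dotC : dot (Defs.center B - Defs.center A) (Defs.center B - Defs.center A)
          = dot (Defs.center A - Defs.center B) (Defs.center A - Defs.center B).
  by rewrite !dotE !mxE; ring.
by rewrite /ring_area; congr (_ * _); lra.
Qed.
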